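(* Let $u=u(x,y)$ be a word in $x$ and $y$ for which the sum of the exponents of $y$ is not divisible by $5$. Then the generalized triangle group $$\langle x,y\,|\,x^2=y^5=u(x,y)^5=1\rangle$$ has a normal subgroup of index $5$ of positive $2$-deficiency.
   Context: Let $p$ be a prime and let $F$ be the free group on a finite set $X$. For a non-trivial $w\in F$, the $p$-valuation $\nu_p(w)$ is the largest integer $k$ such that $w=v^{p^k}$ for some $v\in F$. For a presentation $\langle X|R\rangle$ with $X$ finite ($R\subseteq F$ possibly infinite) its $p$-deficiency is $\mathrm{def}_p\langle X|R\rangle=|X|-1-\sum_{r\in R}p^{-\nu_p(r)}$ (equal to $-\infty$ if the sum diverges). The $p$-deficiency of a finitely generated group $\Gamma$ is the supremum of $\mathrm{def}_p\langle X|R\rangle$ over all presentations $\langle X|R\rangle$ of $\Gamma$ with a finite generating set $X$. The $2$-deficiency is the case $p=2$. Words in $x,y$ may involve negative exponents. *)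

(* Defs.v *)
From HB Require Import structures.
From mathcomp Require Import all_boot all_order all_algebra.
From mathcomp Require Import boolp classical_sets functions cardinality.
From mathcomp Require Import reals ereal esum.

Set Implicit Arguments.
Unset Strict Implicit.
Unset Printing Implicit Defensive.

Import Order.TTheory GRing.Theory Num.Theory.

Local Open Scope classical_set_scope.
Local Open Scope card_scope.
Local Open Scope group_scope.

(* The letter (x, false) stands for x, and (x, true) for x^-1. *)
Definition word (X : Type) := seq (X * bool).

Definition exponent_sum (X : eqType) (x : X) (w : word X) : int :=
  (\sum_(l <- w | l.1 == x) (-1) ^+ l.2)%R.

Section Reduction.
Variable X : eqType.
Implicit Types (l : X * bool) (w : word X).

Definition inv_letter l := (l.1, ~~ l.2).

Definition reduced w : bool := sorted (fun l l' => l' != inv_letter l) w.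

Definition red_cons l w :=
  if w is l' :: w' then if l' == inv_letter l then w' else l :: w else [:: l].

Definition reduce w : word X := foldr red_cons [::] w.

Definition inv_word w : word X := rev (map inv_letter w).

Lemma inv_letterK : involutive inv_letter.
Proof. by case=> x b; rewrite /inv_letter /= negbK. Qed.

Lemma red_cons_reduced l w : reduced w -> reduced (red_cons l w).
Proof.
case: w => [|l' w] //= Hw; case: eqP => [_|/eqP ne]; last by rewrite /= ne.
exact: path_sorted Hw.
Qed.

Lemma foldr_red_cons_reduced u w :
  reduced w -> reduced (foldr red_cons w u).
Proof. by move=> Hw; elim: u => //= l u; apply: red_cons_reduced. Qed.

Lemma reduce_reduced w : reduced (reduce w).
Proof. exact: foldr_red_cons_reduced. Qed.

Lemma reduce_id w : reduced w -> reduce w = w.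
Proof.
elim: w => [|l w IH] //= Hw.
rewrite -/(reduce w) IH; last exact: path_sorted Hw.
by case: w Hw {IH} => [|l' w] //= /andP[/negbTE-> _].
Qed.

Lemma red_consK l w :
  reduced w -> red_cons (inv_letter l) (red_cons l w) = w.
Proof.
case: w => [|l' w] /=; first by rewrite inv_letterK eqxx.
case: (l' =P inv_letter l) => [->|_] /= Hw; last by rewrite inv_letterK eqxx.
by case: w Hw => [|l2 w] //= /andP[/negbTE-> _].
Qed.

Lemma foldr_red_cons l u w : reduced w ->
  foldr red_cons w (red_cons l u) = red_cons l (foldr red_cons w u).
Proof.
move=> Hw; case: u => [|l' u] //=; case: eqP => [->|_] //=.
have := red_consK (inv_letter l) (foldr_red_cons_reduced u Hw).
by rewrite inv_letterK => ->.
Qed.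

Lemma foldr_red_consA u v w : reduced w ->
  foldr red_cons w (foldr red_cons v u)
  = foldr red_cons (foldr red_cons w v) u.
Proof. by move=> Hw; elim: u => //= l u IH; rewrite foldr_red_cons // IH. Qed.

Lemma inv_word_reduced w : reduced w -> reduced (inv_word w).
Proof.
rewrite /inv_word /reduced rev_sorted sorted_map.
by apply: sub_sorted => l l' /=; rewrite inv_letterK eq_sym.
Qed.

Lemma inv_wordK : involutive inv_word.
Proof.
by move=> w; rewrite /inv_word map_rev revK (mapK inv_letterK).
Qed.

Lemma foldr_inv_word w : reduced w -> foldr red_cons w (inv_word w) = [::].
Proof.
elim: w => [|l w IH] //= Hw.
rewrite /inv_word /= rev_cons foldr_rcons /= inv_letterK eqxx.
exact/IH/(path_sorted Hw).
Qed.

End Reduction.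

Section FreeGroup.
Variable X : choiceType.

Record freegroup := FreeGroup { fgword :> seq (X * bool); _ : reduced fgword }.

HB.instance Definition _ := [isSub for fgword].
HB.instance Definition _ := [Choice of freegroup by <:].

Implicit Types u v w : freegroup.

Definition fg_of_word (w : word X) : freegroup :=
  FreeGroup (reduce_reduced w).

Definition fg_gen (x : X) : freegroup := fg_of_word [:: (x, false)].

Definition fg_mul u v : freegroup := fg_of_word (u ++ v).

Definition fg_inv u : freegroup := fg_of_word (inv_word u).

Lemma fgword_inj : injective fgword. Proof. exact: val_inj. Qed.

Lemma fg_mulE u v : fg_mul u v = foldr (@red_cons X) v u :> seq _.
Proof. by rewrite /= /reduce foldr_cat -/(reduce v) reduce_id ?(valP v). Qed.

Lemma fg_mulA : associative fg_mul.
Proof.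
by move=> u v w; apply: fgword_inj; rewrite !fg_mulE foldr_red_consA ?(valP w).
Qed.

Lemma fg_mul1g : left_id (fg_of_word [::]) fg_mul.
Proof. by move=> u; apply: fgword_inj; rewrite !fg_mulE. Qed.

Lemma fg_mulg1 : right_id (fg_of_word [::]) fg_mul.
Proof.
by move=> u; apply: fgword_inj; rewrite !fg_mulE; apply: reduce_id (valP u).
Qed.

Lemma fg_invE u : fg_inv u = inv_word u :> seq _.
Proof. by rewrite /= reduce_id // inv_word_reduced ?(valP u). Qed.

Lemma fg_mulVg : left_inverse (fg_of_word [::]) fg_inv fg_mul.
Proof.
by move=> u; apply: fgword_inj; rewrite fg_mulE fg_invE foldr_inv_word ?(valP u).
Qed.

Lemma fg_mulgV : right_inverse (fg_of_word [::]) fg_inv fg_mul.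
Proof.
move=> u; rewrite -(fg_mulVg (fg_inv u)); congr fg_mul.
by apply: fgword_inj; rewrite !fg_invE inv_wordK.
Qed.

HB.instance Definition _ := isGroup.Build freegroup
  fg_mulA fg_mul1g fg_mulg1 fg_mulVg fg_mulgV.

End FreeGroup.

Section Subgroups.
Variable G : groupType.

Definition normal_subgroup (N : groupClosed G) : Prop :=
  forall x g : G, x \in N -> x ^ g \in N.

Definition left_cosets (N : groupClosed G) : set (set G) :=
  [set [set x * h | h in [set h : G | h \in N]] | x in [set: G]].

Definition has_index (N : groupClosed G) (n : nat) : Prop :=
  left_cosets N #= `I_n.

Definition subgroup_type (N : groupClosed G) : Type := {x : G | x \in N}.

Section SubgroupGroup.
Variable N : groupClosed G.

HB.instance Definition _ := SubChoice.on (subgroup_type N).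

Lemma subgroup_group_closed : group_closed (fun x : G => x \in N).
Proof.
split=> [|x y xN yN]; [exact: gpred1 | exact: (@gpredF _ N _ _ xN yN)].
Qed.

HB.instance Definition _ :=
  SubChoice_isSubGroup.Build G _ (subgroup_type N) subgroup_group_closed.

End SubgroupGroup.

(* The intersection of all normal subgroups of G containing S. *)
Definition normal_closure (S : set G) : {pred G} :=
  fun g => `[< forall N : groupClosed G,
    normal_subgroup N -> S `<=` [set x | x \in N] -> g \in N >].

Section NormalClosureGroup.
Variable S : set G.

Lemma normal_closure_mul1 : 1 \in normal_closure S.
Proof. by apply/asboolP => N _ _; apply: gpred1. Qed.

Lemma normal_closure_mul : mulg_closed (normal_closure S).
Proof.
move=> x y /asboolP Hx /asboolP Hy; apply/asboolP => N nN sN.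
by apply: gpredM; [apply: Hx | apply: Hy].
Qed.

Lemma normal_closure_inv : invg_closed (normal_closure S).
Proof.
by move=> x /asboolP Hx; apply/asboolP => N nN sN; rewrite gpredV; apply: Hx.
Qed.

HB.instance Definition _ := isMulClosed.Build G (normal_closure S)
  normal_closure_mul.
HB.instance Definition _ := isMul1Closed.Build G (normal_closure S)
  normal_closure_mul1.
HB.instance Definition _ := isInvClosed.Build G (normal_closure S)
  normal_closure_inv.
End NormalClosureGroup.

Lemma normal_closure_normal (S : set G) :
  normal_subgroup (normal_closure S : groupClosed G).
Proof.
move=> x g /asboolP Hx; apply/asboolP => N nN sN.
exact: nN (Hx N nN sN).
Qed.

End Subgroups.

Section PresentedGroup.
Variables (X : choiceType) (S : set (freegroup X)).

Definition pres_rel : rel (freegroup X) :=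
  fun u v => u^-1 * v \in normal_closure S.

Lemma pres_rel_refl : reflexive pres_rel.
Proof. by move=> u; rewrite /pres_rel mulVg gpred1. Qed.

Lemma pres_rel_sym : symmetric pres_rel.
Proof. by move=> u v; rewrite /pres_rel -gpredV invgM invgK. Qed.

Lemma pres_rel_trans : transitive pres_rel.
Proof.
move=> v u w; rewrite /pres_rel => Huv Hvw.
by have := gpredM _ _ Huv Hvw; rewrite mulgA mulgK.
Qed.

Canonical pres_equiv := EquivRel pres_rel
  pres_rel_refl pres_rel_sym pres_rel_trans.

Definition presented_group := {eq_quot pres_rel}%qT.

HB.instance Definition _ := EqQuotient.on presented_group.
HB.instance Definition _ := Choice.on presented_group.

Definition pres_pi (u : freegroup X) : presented_group :=
  (\pi_presented_group u)%qT.

Implicit Types x y : presented_group.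

Definition pres_mul x y := pres_pi (repr x * repr y).

Definition pres_inv x := pres_pi (repr x)^-1.

Lemma pres_pi_repr x : pres_pi (repr x) = x.
Proof. exact: reprK. Qed.

Lemma pres_piP u v : reflect (pres_pi u = pres_pi v) (pres_rel u v).
Proof. exact: eqmodP. Qed.

Lemma pres_rel_repr u : pres_rel (repr (pres_pi u)) u.
Proof. by apply/pres_piP; rewrite pres_pi_repr. Qed.

Lemma pres_piM u v : pres_pi (u * v) = pres_mul (pres_pi u) (pres_pi v).
Proof.
apply/esym/pres_piP; rewrite /pres_rel.
set a := repr _; set b := repr _.
have Ha : pres_rel a u by apply: pres_rel_repr.
have Hb : pres_rel b v by apply: pres_rel_repr.
have -> : (a * b)^-1 * (u * v) = (b^-1 * v) * (a^-1 * u) ^ v.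
  by rewrite conjgE invgM !mulgA mulgK.
by apply: gpredM => //; apply: normal_closure_normal.
Qed.

Lemma pres_piV u : pres_pi u^-1 = pres_inv (pres_pi u).
Proof.
apply/esym/pres_piP; rewrite /pres_rel invgK.
set a := repr _.
have Ha : pres_rel u a by rewrite pres_rel_sym; apply: pres_rel_repr.
have -> : a * u^-1 = (u^-1 * a) ^ u^-1 by rewrite conjgE invgK !mulgA mulgV mul1g.
exact: normal_closure_normal.
Qed.

Lemma pres_mulA : associative pres_mul.
Proof.
move=> x y z; rewrite -(pres_pi_repr x) -(pres_pi_repr y) -(pres_pi_repr z).
by rewrite -!pres_piM mulgA.
Qed.

Lemma pres_mul1g : left_id (pres_pi 1) pres_mul.
Proof. by move=> x; rewrite -(pres_pi_repr x) -pres_piM mul1g. Qed.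

Lemma pres_mulg1 : right_id (pres_pi 1) pres_mul.
Proof. by move=> x; rewrite -(pres_pi_repr x) -pres_piM mulg1. Qed.

Lemma pres_mulVg : left_inverse (pres_pi 1) pres_inv pres_mul.
Proof.
by move=> x; rewrite -(pres_pi_repr x) -pres_piV -pres_piM mulVg.
Qed.

Lemma pres_mulgV : right_inverse (pres_pi 1) pres_inv pres_mul.
Proof.
by move=> x; rewrite -(pres_pi_repr x) -pres_piV -pres_piM mulgV.
Qed.

HB.instance Definition _ := isGroup.Build presented_group
  pres_mulA pres_mul1g pres_mulg1 pres_mulVg pres_mulgV.

Lemma pres_pi_is_group_morphism : {morph pres_pi : u v / u / v}.
Proof. by move=> u v; rewrite pres_piM pres_piV. Qed.

HB.instance Definition _ :=
  isGroupMorphism.Build (freegroup X) presented_group pres_pi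
    pres_pi_is_group_morphism.

End PresentedGroup.

Definition group_iso (G H : groupType) : Prop :=
  exists f : {multiplicative G -> H}, bijective f.

Section PDeficiency.
Variables (R : realType) (p : nat).

Definition p_valuation (X : choiceType) (w : freegroup X) : nat :=
  xget 0%N [set k | (exists v : freegroup X, w = v ^+ (p ^ k)%N) /\
    forall j, (exists v : freegroup X, w = v ^+ (p ^ j)%N) -> (j <= k)%N].

(* The p-valuation is defined for w <> 1 only (p_valuation 1 is a junk value);
   the redundant relator 1 gets weight 0 = p^(-oo), so that allowing it in S
   does not change the supremum over all presentations. *)
Definition p_weight (X : choiceType) (w : freegroup X) : R :=
  if w == 1 then 0%R else (p%:R ^- p_valuation w)%R.

(* S may be infinite; the deficiency is -oo when the sum diverges. *)
Definition presentation_p_deficiency (X : finType) (S : set (freegroup X)) :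
    \bar R :=
  ((#|X|%:R - 1)%R%:E - (\esum_(r in S) (p_weight r)%:E)%R)%E.

Definition p_deficiency (G : groupType) : \bar R :=
  ereal_sup [set d : \bar R | exists (X : finType) (S : set (freegroup X)),
    group_iso (presented_group S) G /\ d = presentation_p_deficiency S].

End PDeficiency.

(* The generators x and y are the two elements of bool. *)
Definition gen_x : bool := false.
Definition gen_y : bool := true.

(* < x, y | x ^ a = y ^ b = u (x, y) ^ c = 1 > *)
Definition generalized_triangle_group (a b c : nat) (u : word bool) :
    groupType :=
  presented_group [set fg_gen gen_x ^+ a; fg_gen gen_y ^+ b;
                       fg_of_word u ^+ c].

(* Main.v *)
(* Sending x to 0 and y to 1 maps the group onto Z/5; the kernel is generated
   by the conjugates x_i = y^i x y^-i, 0 <= i < 5. The image k of u is a unit,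
   so the conjugates of the relator u^5 by powers of y are, up to conjugation
   in the kernel, its conjugates by powers of u, all equal to u^5. Hence the
   kernel has the presentation <x_0, ..., x_4 | x_i^2, w> with a single word w
   coming from u^5, and its 2-deficiency is at least 5 - 1 - 5/2 - 1 = 1/2.
   Instead of Reidemeister-Schreier rewriting, the free group on x and y is
   mapped to the semidirect product of the free group on the x_i by Z/5, acting
   by cyclic shift of the indices. *)
Require Import Defs.
From HB Require Import structures.
From mathcomp Require Import all_boot all_order all_algebra.
From mathcomp Require Import boolp classical_sets functions cardinality.
From mathcomp Require Import reals ereal esum.
From mathcomp Require Import fsbigop lra.

Set Implicit Arguments.
Unset Strict Implicit.
Unset Printing Implicit Defensive.

Import Order.TTheory GRing.Theory Num.Theory.

Local Open Scope classical_set_scope.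
Local Open Scope group_scope.

(** * Universal property of free groups and induction on their elements *)

Section FreeGroupLift.
Variables (X : choiceType) (H : groupType) (f : X -> H).

Definition letter_eval (l : X * bool) : H := if l.2 then (f l.1)^-1 else f l.1.

Definition word_eval (w : word X) : H :=
  foldr (fun l h => letter_eval l * h) 1 w.

Lemma letter_evalV l : letter_eval (inv_letter l) = (letter_eval l)^-1.
Proof. by case: l => x []; rewrite /letter_eval //= invgK. Qed.

Lemma word_eval_cat v w : word_eval (v ++ w) = word_eval v * word_eval w.
Proof. by elim: v => [|l v IH] /=; rewrite ?mul1g // IH mulgA. Qed.

Lemma word_eval_reduce w : word_eval (reduce w) = word_eval w.
Proof.
elim: w => //= l w <-; case: (reduce w) => [|l' v] //=.
by case: eqP => //= ->; rewrite letter_evalV mulVKg.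
Qed.

Definition fg_lift (v : freegroup X) : H := word_eval v.

Lemma fg_lift_of_word w : fg_lift (fg_of_word w) = word_eval w.
Proof. exact: word_eval_reduce. Qed.

Lemma fg_liftM : {morph fg_lift : v w / v * w}.
Proof. by move=> v w; rewrite -word_eval_cat -fg_lift_of_word. Qed.

Lemma fg_lift1 : fg_lift 1 = 1.
Proof. exact: fg_lift_of_word. Qed.

HB.instance Definition _ := isMultiplicative.Build _ _ fg_lift fg_liftM.
HB.instance Definition _ :=
  Multiplicative_isUMagmaMorphism.Build _ _ fg_lift fg_lift1.

Lemma fg_lift_gen x : fg_lift (fg_gen x) = f x.
Proof. by rewrite fg_lift_of_word /= mulg1. Qed.

End FreeGroupLift.

Lemma fg_of_word_cat (X : choiceType) (v w : word X) :
  fg_of_word (v ++ w) = fg_of_word v * fg_of_word w.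
Proof.
apply: fgword_inj; rewrite fg_mulE /= /reduce foldr_cat.
rewrite -/(reduce w); have Hr := reduce_reduced w.
by elim: v => //= l v ->; rewrite -/(reduce v) foldr_red_cons.
Qed.

Lemma fg_ind (X : choiceType) (P : freegroup X -> Prop) :
    P 1 -> (forall v w, P v -> P w -> P (v * w)) ->
    (forall v, P v -> P v^-1) -> (forall x, P (fg_gen x)) ->
  forall v, P v.
Proof.
move=> P1 PM PV Pg v; have -> : v = fg_of_word v.
  by apply: fgword_inj; rewrite /= reduce_id ?(valP v).
elim: (fgword v) => // l w IH; rewrite -cat1s fg_of_word_cat; apply: PM => //.
have -> : fg_of_word [:: l] = if l.2 then (fg_gen l.1)^-1 else fg_gen l.1.
  by case: l => x [] //=; apply: fgword_inj.
by case: ifP => _ //; apply: PV.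
Qed.

(** The elements satisfying [P] form one of the normal subgroups whose intersection is the
    closure. *)
Lemma normal_closure_ind (G : groupType) (S : set G) (P : G -> Prop) :
    P 1 -> (forall x y, P x -> P y -> P (x * y)) ->
    (forall x, P x -> P x^-1) -> (forall x g, P x -> P (x ^ g)) ->
    S `<=` P -> forall g, g \in normal_closure S -> P g.
Proof.
move=> P1 PM PV PJ SP g /asboolP Hg.
pose N : {pred G} := fun g => `[< P g >].
have NM : mulg_closed N.
  by move=> x y /asboolP Hx /asboolP Hy; apply/asboolP/PM.
have N1 : 1 \in N by apply/asboolP.
have NV : invg_closed N by move=> x /asboolP Hx; apply/asboolP/PV.
pose m1 := isMulClosed.Build G N NM.
pose m2 := isMul1Closed.Build G N N1.
pose m3 := isInvClosed.Build G N NV.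
pose NG : groupClosed G := HB.pack N m1 m2 m3.
apply/asboolP; apply: (Hg NG) => [x h /asboolP Hx|x Sx].
  exact/asboolP/PJ.
exact/asboolP/SP.
Qed.

Lemma sub_normal_closure (G : groupType) (S : set G) g :
  S g -> g \in normal_closure S.
Proof. by move=> Sg; apply/asboolP => N _; apply. Qed.

(** * Maps out of a presented group *)

Section PresentedGroupLift.
Variables (X : choiceType) (S : set (freegroup X)) (H : groupType).
(* The structure {multiplicative _ -> _} does not provide f 1 = 1. *)
Variable f : UMagmaMorphism.type (freegroup X) H.
Hypothesis fS : forall r, S r -> f r = 1.

Lemma normal_closure_ker v : v \in normal_closure S -> f v = 1.
Proof.
apply: (normal_closure_ind (P := fun v => f v = 1)) => //.
- exact: gmulf1.
- by move=> x y fx fy; rewrite gmulfM fx fy mulg1.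
- by move=> x fx; rewrite gmulfV fx invg1.
- by move=> x g fx; rewrite gmulfJ fx conj1g.
Qed.

(* The proof argument lets the morphism instance be inferred from the term. *)
Definition pres_lift of (forall r, S r -> f r = 1) :=
  fun x : presented_group S => f (repr x).

Lemma pres_lift_pi v : pres_lift fS (pres_pi S v) = f v.
Proof.
have /normal_closure_ker := pres_rel_repr S v.
by rewrite gmulfM gmulfV => /mulg1_eq; rewrite invgK.
Qed.

Lemma pres_liftM : {morph pres_lift fS : x y / x * y}.
Proof.
move=> x y; rewrite -(pres_pi_repr x) -(pres_pi_repr y) -gmulfM.
by rewrite !pres_lift_pi gmulfM.
Qed.

Lemma pres_lift1 : pres_lift fS 1 = 1.
Proof. by rewrite pres_lift_pi gmulf1. Qed.

HB.instance Definition _ :=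
  isMultiplicative.Build _ _ (pres_lift fS) pres_liftM.
HB.instance Definition _ :=
  Multiplicative_isUMagmaMorphism.Build _ _ (pres_lift fS) pres_lift1.

End PresentedGroupLift.

Lemma pres_pi_eq1 (X : choiceType) (S : set (freegroup X)) v :
  pres_pi S v = 1 <-> v \in normal_closure S.
Proof.
split=> [/esym/pres_piP|Sv]; first by rewrite /pres_rel invg1 mul1g.
by apply/esym/pres_piP; rewrite /pres_rel invg1 mul1g.
Qed.

Lemma pres_piS (X : choiceType) (S : set (freegroup X)) r :
  S r -> pres_pi S r = 1.
Proof. by move=> Sr; apply/pres_pi_eq1/sub_normal_closure. Qed.

(** * Kernels of group morphisms and their index *)

Section Kernel.
Variables (G H : groupType) (f : UMagmaMorphism.type G H).

Definition ker : {pred G} := fun g => f g == 1.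

Lemma ker_mul : mulg_closed ker.
Proof.
by move=> x y /eqP fx /eqP fy; rewrite -topredE /= /ker gmulfM fx fy mulg1.
Qed.

Lemma ker1 : 1 \in ker.
Proof. by rewrite -topredE /= /ker gmulf1. Qed.

Lemma ker_inv : invg_closed ker.
Proof. by move=> x /eqP fx; rewrite -topredE /= /ker gmulfV fx invg1. Qed.

HB.instance Definition _ := isMulClosed.Build G ker ker_mul.
HB.instance Definition _ := isMul1Closed.Build G ker ker1.
HB.instance Definition _ := isInvClosed.Build G ker ker_inv.

Lemma kerE g : (g \in ker) = (f g == 1).
Proof. by []. Qed.

Lemma ker_normal : normal_subgroup (ker : groupClosed G).
Proof. by move=> x g /eqP fx; rewrite kerE gmulfJ fx conj1g. Qed.

(** The cosets of the kernel are the fibres of [f], so they are counted by representatives whose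
    images list [H] without repetition. *)
Lemma ker_has_index n (e : nat -> G) :
  set_bij `I_n [set: H] (f \o e) -> has_index (ker : groupClosed G) n.
Proof.
case=> _ einj esurj.
pose coset x := [set x * h | h in [set h : G | h \in ker]].
have cosetP x g : coset x g <-> f g = f x.
  split=> [[h /eqP fh <-]|fgx]; first by rewrite gmulfM fh mulg1.
  by exists (x^-1 * g); rewrite ?mulVKg //= kerE gmulfM gmulfV fgx mulVg.
rewrite /has_index.
have -> : left_cosets (ker : groupClosed G) = (coset \o e) @` `I_n.
  apply/seteqP; split=> [_ [x _ <-]|_ [k _ <-]]; last by exists (e k).
  have [k kn fk] := esurj (f x) I; exists k => //=.
  by apply/seteqP; split=> g /cosetP fg; apply/cosetP; rewrite fg.
apply: inj_card_eq => k l kn ln /= ekl; apply: einj => //=.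
by apply/cosetP; rewrite -ekl; apply/cosetP.
Qed.

End Kernel.

(** * The cyclic group of order n on ordinals *)

Section CyclicOrdinal.
Variable q : nat.
Local Notation n := q.+1.

(** The group law on ['I_n] is addition modulo n, so a power [k ^+ e] is a multiple of k. *)
Definition ord_gen : 'I_n := inZp 1.

Lemma ord_genX k : ord_gen ^+ k = inZp k.
Proof.
elim: k => [|k IH]; first exact: val_inj.
by rewrite expgS IH; apply: val_inj; rewrite /= modnDml modnDmr.
Qed.

Lemma ord_expgn (i : 'I_n) : i ^+ n = 1.
Proof.
rewrite -(valZpK i) -ord_genX -expgnA mulnC expgnA ord_genX.
have -> : inZp n = 1 :> 'I_n by apply: val_inj; rewrite /= modnn.
by rewrite expg1n.
Qed.

Lemma ord_genMz_eq0 (z : int) : (ord_gen *~ z == 0)%R = (n %| z)%Z.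
Proof.
have mulnE m : (ord_gen *+ m == 0)%R = (n %| m)%N.
  rewrite (_ : ord_gen *+ m = inZp m)%R // -ord_genX.
  by elim: m => // m IH; rewrite mulrS expgS IH.
case: z => m; first exact: mulnE.
by rewrite NegzE mulrNz oppr_eq0 rpredN; apply: mulnE.
Qed.

Lemma ord_expg_surj (i k : 'I_n) : coprime k n -> exists e, i = k ^+ e.
Proof.
(* Bezout needs k > 0; the value k = 0 is coprime to n only when n = 1. *)
have [k0|k_gt0] := posnP k.
  rewrite k0 /coprime gcd0n => /eqP n1; exists 0%N; apply: val_inj => /=.
  by have := ltn_ord i; rewrite [X in (_ < X)%N]n1 ltnS leqn0 => /eqP.
(* The Bezout coefficient [km] inverts k modulo n, hence the exponent [km * i]. *)
case: (egcdnP n k_gt0) => km kn E _ /eqP co; exists (km * i)%N.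
rewrite -[in RHS](valZpK k) -ord_genX -expgnA ord_genX mulnA [(k * km)%N]mulnC.
rewrite E co; apply: val_inj.
by rewrite /= mulnDl mul1n mulnAC modnMDl modn_small.
Qed.

End CyclicOrdinal.

(* The semidirect product of the free group on A by A, which acts on the free
   generators by left translation (the cyclic shift of the x_i when A = Z/n). *)
Section ShiftProduct.
Variable A : groupType.

Definition shift (a : A) : freegroup A -> freegroup A :=
  fg_lift (fun b => fg_gen (a * b)).

HB.instance Definition _ a := UMagmaMorphism.on (shift a).

Lemma shift_gen a b : shift a (fg_gen b) = fg_gen (a * b).
Proof. exact: fg_lift_gen. Qed.

Lemma shift1 v : shift 1 v = v.
Proof.
elim/fg_ind: v => [|v w Hv Hw|v Hv|b]; last by rewrite shift_gen mul1g.
- exact: gmulf1.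
- by rewrite gmulfM /= Hv Hw.
- by rewrite gmulfV /= Hv.
Qed.

Lemma shiftM a b v : shift (a * b) v = shift a (shift b v).
Proof.
elim/fg_ind: v => [|v w Hv Hw|v Hv|c]; last by rewrite !shift_gen mulgA.
- by rewrite !gmulf1.
- by rewrite !gmulfM /= Hv Hw.
- by rewrite !gmulfV /= Hv.
Qed.

Definition shift_prod : Type := (freegroup A * A)%type.

HB.instance Definition _ := Choice.on shift_prod.

Definition sp_mul (s t : shift_prod) : shift_prod :=
  (s.1 * shift s.2 t.1, s.2 * t.2).

Definition sp_inv (s : shift_prod) : shift_prod :=
  (shift s.2^-1 s.1^-1, s.2^-1).

Lemma sp_mulA : associative sp_mul.
Proof.
by move=> s t r; rewrite /sp_mul /= shiftM gmulfM !mulgA.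
Qed.

Lemma sp_mul1g : left_id (1, 1) sp_mul.
Proof. by case=> v a; rewrite /sp_mul /= shift1 !mul1g. Qed.

Lemma sp_mulg1 : right_id (1, 1) sp_mul.
Proof. by case=> v a; rewrite /sp_mul /= gmulf1 !mulg1. Qed.

Lemma sp_mulVg : left_inverse (1, 1) sp_inv sp_mul.
Proof. by case=> v a; rewrite /sp_mul /= -gmulfM !mulVg gmulf1. Qed.

Lemma sp_mulgV : right_inverse (1, 1) sp_inv sp_mul.
Proof.
by case=> v a; rewrite /sp_mul /= -shiftM !mulgV shift1 mulgV.
Qed.

HB.instance Definition _ := isGroup.Build shift_prod
  sp_mulA sp_mul1g sp_mulg1 sp_mulVg sp_mulgV.

Lemma spM (s t : shift_prod) : s * t = (s.1 * shift s.2 t.1, s.2 * t.2).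
Proof. by []. Qed.

Lemma spV (s : shift_prod) : s^-1 = (shift s.2^-1 s.1^-1, s.2^-1).
Proof. by []. Qed.

Definition sp_snd (s : shift_prod) : A := s.2.

Definition sp_inl (v : freegroup A) : shift_prod := (v, 1).

Definition sp_inr (a : A) : shift_prod := (1, a).

Fact sp_snd_morph : monoid.monoid_morphism sp_snd.
Proof. by []. Qed.

Fact sp_inl_morph : monoid.monoid_morphism sp_inl.
Proof. by split=> // v w; rewrite spM /= shift1 mulg1. Qed.

Fact sp_inr_morph : monoid.monoid_morphism sp_inr.
Proof. by split=> // a b; rewrite spM /= gmulf1 mulg1. Qed.

HB.instance Definition _ := isUMagmaMorphism.Build _ _ sp_snd sp_snd_morph.
HB.instance Definition _ := isUMagmaMorphism.Build _ _ sp_inl sp_inl_morph.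
HB.instance Definition _ := isUMagmaMorphism.Build _ _ sp_inr sp_inr_morph.

(** Inside the semidirect product the action becomes conjugation; the inverse is there because
    [g ^ h] means h^-1 g h. *)
Lemma sp_inlJ v a : sp_inl v ^ (sp_inr a)^-1 = sp_inl (shift a v).
Proof.
rewrite conjgE invgK mulgA; apply: canLR (mulgK _) _.
by rewrite !spM /= gmulf1 !mulg1 !mul1g.
Qed.

End ShiftProduct.

(** * The kernel of the map onto Z/n and its presentation *)

Section CyclicCover.
Variables (q a : nat) (u : word bool).
Local Notation n := q.+1.
Local Notation A := 'I_n.
Local Notation F := (freegroup bool).
Local Notation G := (generalized_triangle_group a n n u).

Local Notation S := [set fg_gen gen_x ^+ a; fg_gen gen_y ^+ n;
                        fg_of_word u ^+ n].

(** The index 1 is the neutral element of [A], i.e. the ordinal 0, so x goes to x_0 and y to the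
    one-step shift. *)
Definition theta : F -> shift_prod A :=
  fg_lift (fun b => if b then sp_inr (ord_gen q) else sp_inl (fg_gen 1)).

HB.instance Definition _ := UMagmaMorphism.on theta.

Lemma theta_x : theta (fg_gen gen_x) = sp_inl (fg_gen 1).
Proof. exact: fg_lift_gen. Qed.

Lemma theta_y : theta (fg_gen gen_y) = sp_inr (ord_gen q).
Proof. exact: fg_lift_gen. Qed.

(** This is u^n rewritten in the x_i. The dropped second component is trivial, being an nth power in
    [A]. *)
Definition u_rel : freegroup A := (theta (fg_of_word u ^+ n)).1.

Definition cover_rels : set (freegroup A) :=
  [set fg_gen i ^+ a | i in [set: A]] `|` [set u_rel].

Local Notation M := (normal_closure cover_rels).

Lemma theta_uX : theta (fg_of_word u ^+ n) = sp_inl u_rel.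
Proof.
rewrite /sp_inl /u_rel; case E: (theta _) => [v b] /=; congr (_, _).
by rewrite -[b]/(sp_snd (v, b)) -E !gmulfXn ord_expgn.
Qed.

Lemma theta_exponent w :
  sp_snd (theta (fg_of_word w)) = (ord_gen q *~ exponent_sum gen_y w)%R.
Proof.
rewrite /theta fg_lift_of_word /exponent_sum; set f := (f in word_eval f).
elim: w => [|l w IH]; first by rewrite big_nil.
transitivity (sp_snd (letter_eval f l) + sp_snd (word_eval f w))%R => //.
rewrite big_cons IH; case: l => [[] e] /=.
  by rewrite mulrzDr; case: e; rewrite ?mulrN1z ?mulr1z.
rewrite [X in (X + _)%R](_ : _ = 0%R) ?add0r //.
by case: e => //; apply: invg1.
Qed.

Hypothesis u_gen : forall i : A, exists k,
  i = sp_snd (theta (fg_of_word u)) ^+ k.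

(** Since the degree of u generates [A], only the shift by that degree matters. It permutes the
    relators x_i^a and sends [u_rel] to a conjugate of itself. *)
Lemma shift_rels i v : v \in M -> shift i v \in M.
Proof.
have [k ->] := u_gen i; set s := theta _.
suff H w : w \in M -> shift (sp_snd s) w \in M.
  elim: k v => [|k IH] v Mv; first by rewrite expg0 shift1.
  by rewrite expgS shiftM; apply/H/IH.
apply: (normal_closure_ind (P := fun w => is_true (shift (sp_snd s) w \in M))).
- by rewrite gmulf1 gpred1.
- by move=> x y Mx My; rewrite gmulfM gpredM.
- by move=> x Mx; rewrite gmulfV gpredV.
- by move=> x g Mx; rewrite gmulfJ; apply: normal_closure_normal.
move=> _ [[j _ <-]|->].
  rewrite gmulfXn /= shift_gen; apply: sub_normal_closure; left.
  by exists (sp_snd s * j).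
(* Compare first components in the identity saying that the image of u commutes with that of u^n. *)
have -> : shift (sp_snd s) u_rel = u_rel ^ s.1.
  have E : s.1 * shift (sp_snd s) u_rel = u_rel * s.1.
    rewrite -[in RHS](shift1 s.1).
    have /(congr1 fst) // : s * sp_inl u_rel = sp_inl u_rel * s.
    by rewrite -theta_uX gmulfXn; apply: commuteX.
  by rewrite /conjg -E mulKg.
by apply: normal_closure_normal; apply: sub_normal_closure; right.
Qed.

(** By [shift_rels], the copy of [M] in the free factor is normal in the whole semidirect product,
    so only the three relators remain to be checked. *)
Lemma theta_rels v : v \in normal_closure S ->
  exists2 m, m \in M & theta v = sp_inl m.
Proof.
apply: (normal_closure_ind
  (P := fun v => exists2 m, m \in M & theta v = sp_inl m)).
- by exists 1; rewrite ?gpred1 ?gmulf1.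
- move=> x y [m Mm xm] [m' Mm' ym]; exists (m * m'); first exact: gpredM.
  by rewrite !gmulfM /= xm ym.
- by move=> x [m Mm xm]; exists m^-1; rewrite ?gpredV // !gmulfV /= xm.
- move=> x g [m Mm xm]; rewrite gmulfJ /= xm.
  exists (shift (theta g).2^-1 (m ^ (theta g).1)).
    by apply: shift_rels; apply: normal_closure_normal.
  rewrite conjgE !spM /= shift1 mul1g mulVg /sp_inl; congr (_, _).
  by rewrite -gmulfM.
move=> r [[->|->]|->].
- exists (fg_gen 1 ^+ a); last by rewrite !gmulfXn /= theta_x.
  by apply: sub_normal_closure; left; exists 1.
- by exists 1; rewrite ?gpred1 // gmulfXn /= theta_y -gmulfXn ord_expgn !gmulf1.
- by exists u_rel; [apply: sub_normal_closure; right | apply: theta_uX].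
Qed.

Local Notation piG := (pres_pi S).
Local Notation x := (piG (fg_gen gen_x)).
Local Notation y := (piG (fg_gen gen_y)).

Lemma degree_rels r : S r -> sp_snd (theta r) = 1.
Proof. by move=> Sr; have [m _ ->] := theta_rels (sub_normal_closure Sr). Qed.

Definition degree : G -> A :=
  @pres_lift _ S _ (sp_snd (A:=A) \o theta) degree_rels.

HB.instance Definition _ := UMagmaMorphism.on degree.

Lemma degree_pi v : degree (piG v) = sp_snd (theta v).
Proof. exact: pres_lift_pi. Qed.

Lemma y_expgn : y ^+ n = 1.
Proof. by rewrite -gmulfXn; apply: pres_piS; left; right. Qed.

Lemma y_expg_mod k : y ^+ (k %% n) = y ^+ k.
Proof.
by rewrite [in RHS](divn_eq k n) expgnDr mulnC expgnA y_expgn expg1n mul1g.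
Qed.

(** The generator x_i goes to y^i x y^-i. *)
Definition cover_lift : freegroup A -> F :=
  fg_lift (fun i : A => fg_gen gen_x ^ (fg_gen gen_y ^- i)).

HB.instance Definition _ := UMagmaMorphism.on cover_lift.

Lemma theta_cover_lift v : theta (cover_lift v) = sp_inl v.
Proof.
elim/fg_ind: v => [|v w Hv Hw|v Hv|i].
- by rewrite !gmulf1.
- by rewrite !gmulfM /= Hv Hw.
- by rewrite !gmulfV /= Hv.
rewrite [cover_lift _]fg_lift_gen gmulfJ gmulfV gmulfXn /= theta_x theta_y.
by rewrite -gmulfXn ord_genX valZpK sp_inlJ shift_gen mulg1.
Qed.

(** This is asserted in [G], not in [F]: indices are added modulo n, which is harmless only once y^n
    = 1. *)
Lemma cover_lift_shift i v :
  piG (cover_lift (shift i v)) = piG (cover_lift v) ^ (y ^- i).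
Proof.
elim/fg_ind: v => [|v w Hv Hw|v Hv|j].
- by rewrite !gmulf1 conj1g.
- by rewrite !gmulfM /= Hv Hw conjMg.
- by rewrite !gmulfV /= Hv conjVg.
rewrite shift_gen ![cover_lift _]fg_lift_gen !gmulfJ -conjgM !gmulfV !gmulfXn.
by rewrite -invgM -expgnDr y_expg_mod.
Qed.

(** Normal form in [G]: a word in the conjugates y^i x y^-i times a power of y. This takes the place
    of the rewriting process, and [cover_lift_shift] moves powers of y past such words. *)
Lemma cover_lift_theta v :
  piG v = piG (cover_lift (theta v).1) * y ^+ (theta v).2.
Proof.
elim/fg_ind: v => [|v w Hv Hw|v Hv|b].
- by rewrite !gmulf1 mulg1.
- rewrite [in LHS]gmulfM /= Hv Hw.
  rewrite (_ : theta (v * w) = theta v * theta w); last exact: gmulfM.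
  case: (theta v) (theta w) => [v' i] [w' j]; rewrite spM /= y_expg_mod expgnDr.
  by rewrite !gmulfM /= cover_lift_shift conjgE invgK !mulgA mulgVK.
- rewrite [in LHS]gmulfV /= Hv.
  rewrite (_ : theta v^-1 = (theta v)^-1); last exact: gmulfV.
  case: (theta v) => [v' i]; rewrite spV /= cover_lift_shift !gmulfV /=.
  (* The ordinal [i^-1] is the residue of -i, so its sum with i is a multiple of n. *)
  have -> : y ^+ (i^-1 : A) = y ^- i.
    apply/esym/mulg1_eq; rewrite -expgnDr -y_expg_mod.
    by rewrite -[(_ %% _)%N]/(nat_of_ord (i * i^-1)) mulgV.
  by rewrite invgM conjgE !invgK mulgA mulgK.
case: b; rewrite ?theta_x ?theta_y /=.
  by rewrite (_ : cover_lift 1 = 1) ?gmulf1 ?mul1g ?y_expg_mod // gmulf1.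
by rewrite mulg1 [cover_lift _]fg_lift_gen expg0 invg1 conjg1.
Qed.

Lemma cover_rels_pi r : cover_rels r -> piG (cover_lift r) = 1.
Proof.
case=> [[i _ <-]|->].
  rewrite !gmulfXn /= [cover_lift _]fg_lift_gen gmulfJ -conjXg -gmulfXn.
  by rewrite /= pres_piS ?conj1g //; left; left.
(* The normal form of u^n has trivial y-part, so [u_rel] lifts to u^n in [G]. *)
have := cover_lift_theta (fg_of_word u ^+ n).
by rewrite theta_uX mulg1 => <-; apply: pres_piS; right.
Qed.

Definition cover : presented_group cover_rels -> G :=
  @pres_lift _ cover_rels _ (piG \o cover_lift) cover_rels_pi.

HB.instance Definition _ := UMagmaMorphism.on cover.

Lemma cover_pi v : cover (pres_pi _ v) = piG (cover_lift v).
Proof. exact: pres_lift_pi. Qed.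

(** If the lift of v dies in [G], [theta_rels] puts its image under [theta] in [M]; that image is v
    itself. *)
Lemma cover_inj : injective cover.
Proof.
apply: gmulf_inj => p /=; rewrite -(pres_pi_repr p) cover_pi.
move=> /pres_pi_eq1 /theta_rels [m Mm]; rewrite theta_cover_lift => -[->].
exact/pres_pi_eq1.
Qed.

Lemma cover_ker p : cover p \in ker degree.
Proof.
by rewrite kerE /= -(pres_pi_repr p) cover_pi degree_pi theta_cover_lift.
Qed.

(** On elements of trivial degree the normal form loses its power of y, which yields an explicit
    preimage. *)
Lemma ker_cover g : g \in ker degree ->
  cover (pres_pi _ (theta (repr g)).1) = g.
Proof.
rewrite kerE /= -{1}(pres_pi_repr g) degree_pi => /eqP g1.
rewrite cover_pi -[RHS]pres_pi_repr [RHS]cover_lift_theta.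
by rewrite -[(theta _).2]/(sp_snd _) g1 mulg1.
Qed.

Lemma cover_iso :
  group_iso (presented_group cover_rels)
            (subgroup_type (ker degree : groupClosed G)).
Proof.
pose f p : subgroup_type (ker degree : groupClosed G) :=
    Sub (cover p) (cover_ker p).
have fM : {morph f : p r / p * r}.
  by move=> p r; apply: val_inj; rewrite /= gmulfM.
pose m := isMultiplicative.Build _ _ f fM.
exists (HB.pack_for {multiplicative _ -> _} f m).
exists (fun g => pres_pi _ (theta (repr (val g))).1) => [p|g].
  by apply: cover_inj; rewrite ker_cover // cover_ker.
by apply: val_inj; rewrite /= ker_cover // (valP g).
Qed.

Lemma degree_has_index : has_index (ker degree : groupClosed G) n.
Proof.
have degY k : degree (y ^+ k) = inZp k.
  by rewrite gmulfXn /= degree_pi theta_y ord_genX.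
apply: (@ker_has_index _ _ degree n (fun k => y ^+ k)); split=> //.
- move=> k l; rewrite !inE /= => kn ln; rewrite !degY.
  by move=> /(congr1 val); rewrite /= !modn_small.
- by move=> i _; exists i => //=; rewrite degY valZpK.
Qed.

End CyclicCover.

(** * Bounds on p-weights and on the deficiency of the cover *)

Section Weights.
Variables (R : realType) (p : nat).
Hypothesis p_gt1 : (1 < p)%N.

Lemma p_weight_ge0 (X : choiceType) (v : freegroup X) : (0 <= p_weight R p v)%R.
Proof.
by rewrite /p_weight; case: ifP => // _; rewrite invr_ge0 exprn_ge0 ?ler0n.
Qed.

Lemma p_weight_le1 (X : choiceType) (v : freegroup X) : (p_weight R p v <= 1)%R.
Proof.
rewrite /p_weight; case: ifP => // _.
by rewrite invf_le1 ?exprn_gt0 ?exprn_ege1 ?ler1n ?ltr0n // ltnW.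
Qed.

(** Map the free group to Z/p^2 by x to 1 and the other generators to 0: x^p goes to p, which is
    nonzero, whereas p^k-th powers with k > 1 vanish. *)
Lemma p_valuation_gen (X : choiceType) (x : X) :
  p_valuation p (fg_gen x ^+ p) = 1%N.
Proof.
have p_gt0 := ltnW p_gt1.
pose e v := (exists w : freegroup X, fg_gen x ^+ p = w ^+ (p ^ v)%N).
have e_le1 k : e k -> (k <= 1)%N.
  case=> w; rewrite leqNgt => xw; apply/negP => k_gt1.
  have [m Em] : exists m, (p ^ 2)%N = m.+1.
    by exists (p ^ 2).-1; rewrite prednK // expn_gt0 p_gt0.
  pose f : freegroup X -> 'I_m.+1 :=
    fg_lift (fun t => if t == x then ord_gen m else 1).
  have fX v j : f (v ^+ j) = f v ^+ j by apply: gmulfXn.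
  have /(congr1 (fun v => val (f v))) := xw.
  rewrite !fX [f (fg_gen x)]fg_lift_gen eqxx ord_genX.
  rewrite -(subnKC k_gt1) expnD expgnA Em ord_expgn expg1n /= -Em modn_small.
    by move=> p0; rewrite p0 in p_gt0.
  by rewrite -[X in (X < _)%N]expn1 ltn_exp2l.
rewrite /p_valuation; case: xgetP => [k _ [ek kmax]|H].
  by apply/eqP; rewrite eqn_leq e_le1 // kmax //; exists (fg_gen x).
(* The default of [xget] is never taken, as 1 attains the maximum. *)
by case: (H 1%N); split; [exists (fg_gen x) | apply: e_le1].
Qed.

Lemma p_weight_gen_le (X : choiceType) (x : X) :
  (p_weight R p (fg_gen x ^+ p)%g <= p%:R^-1)%R.
Proof.
rewrite /p_weight p_valuation_gen expr1.
by case: ifP => // _; rewrite invr_ge0 ler0n.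
Qed.

End Weights.

(** Common points count twice on the right, which nonnegativity permits; thus [u_rel] need not be
    compared with the squares x_i^2. *)
Lemma le_esum_setU (R : realType) (T : choiceType) (A B : set T)
    (a : T -> \bar R) :
  (forall i, (0 <= a i)%E) ->
  ((\esum_(i in A `|` B) a i)%R <=
    (\esum_(i in A) a i)%R + (\esum_(i in B) a i)%R)%E.
Proof.
move=> a0; rewrite (esumID A) // setUK; apply: leeD => //.
rewrite esum_mkcond [leRHS]esum_mkcond; apply: le_esum => i _.
case: ifPn => [/set_mem[[//|Bi] _]|_]; first by rewrite mem_set.
by case: ifP.
Qed.

Lemma cover_rels_deficiency (R : realType) q u :
  ((q.+1%:R - 1 - (q.+1%:R / 2 + 1))%:E <=
    presentation_p_deficiency R 2 (@cover_rels q 2 u))%E.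
Proof.
rewrite /presentation_p_deficiency card_ord EFinB leeB //.
apply: (le_trans (le_esum_setU _ _ _)) => [i|].
  by rewrite lee_fin p_weight_ge0.
rewrite EFinD; apply: leeD; last first.
  by rewrite esum_set1 lee_fin ?p_weight_ge0 ?p_weight_le1.
(* The squares x_i^2 are distinct reduced words, so their weights are summed over the indices. *)
rewrite esum_image; last first.
  move=> i j _ _ /(congr1 (@fgword _)).
  by rewrite !expg2 !fg_mulE /= !xpair_eqE !andbF => -[].
rewrite esum_fset; [|exact: finite_finset|] => [|i _]; last first.
  by rewrite lee_fin p_weight_ge0.
rewrite -(_ : [set` index_enum 'I_q.+1] = [set: 'I_q.+1]); last first.
  by apply/seteqP; split=> // i _; rewrite /= mem_index_enum.
rewrite -fsbig_seq ?index_enum_uniq //.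
apply: (@le_trans _ _ (\sum_(i < q.+1) (2^-1 : R)%:E)%E).
  by apply: lee_sum => i _; rewrite lee_fin p_weight_gen_le.
by rewrite sumEFin sumr_const card_ord mulr_natl.
Qed.


Theorem corollary10 (R : realType) (u : word bool)
    (u_expy : ~~ (5 %| exponent_sum gen_y u)%Z) :
  exists N : groupClosed (generalized_triangle_group 2 5 5 u),
    [/\ normal_subgroup N,
        has_index N 5 &
        (0 < p_deficiency R 2 (subgroup_type N))%E].
Proof.
have u_gen i : exists k, i = sp_snd (theta 4 (fg_of_word u)) ^+ k.
  (* As 5 is prime, a nonzero exponent sum modulo 5 is coprime to 5. *)
  apply: ord_expg_surj; rewrite theta_exponent.
  move: u_expy; rewrite -(ord_genMz_eq0 4); set k := (_ *~ _)%R => k0.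
  rewrite coprime_sym prime_coprime // /dvdn modn_small //.
exists (ker (degree (a := 2) u_gen) : groupClosed _); split.
- exact: ker_normal.
- exact: degree_has_index.
apply: (@lt_le_trans _ _ (2^-1 : R)%:E); first by rewrite lte_fin invr_gt0.
apply: (@le_trans _ _ (presentation_p_deficiency R 2 (@cover_rels 4 2 u))).
  apply: le_trans (cover_rels_deficiency R 4 u); rewrite lee_fin.
  lra.
apply: ereal_sup_ubound; exists 'I_5, (@cover_rels 4 2 u); split=> //.
exact: cover_iso.
Qed.
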